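(* Let $\phi:[0,\infty)\to\mathbb{R}$ be a (not necessarily continuous) function satisfying Properties 1, 2 and 3 (invariance of constants, monotonicity, and the variation-diminishing property), as defined in the context. Then $$\phi(s)=\lambda e^{-\lambda s}\qquad\text{for some }\lambda>0.$$
   Context: For a weight $\phi:[0,\infty)\to\mathbb{R}$ and a continuous function $f:\mathbb{R}\to\mathbb{R}$, the one-sided average of $f$ is $$g(t)=\int_0^\infty f(t-s)\,\phi(s)\,ds,\qquad t\in\mathbb{R}.$$ Throughout, $f$ ranges over the continuous functions $\mathbb{R}\to\mathbb{R}$ for which this integral converges absolutely for every $t\in\mathbb{R}$, and $g$ denotes the average of $f$. Property 1 (Invariance of constants). Averaging leaves constant functions invariant: for every constant $c$, if $f\equiv c$ then $g$ is defined and $g\equiv c$. Equivalently, $\phi$ is integrable and $\int_0^\infty\phi(s)\,ds=1$. Property 2 (Monotonicity). $\phi$ is (not necessarily strictly) monotonically decreasing on $[0,\infty)$. Property 3 (Variation-diminishing property). For every such $f$, every $c\in\mathbb{R}$ and every natural number $n$: (i) if the set $\{t\in\mathbb{R}: f(t)>c\}$ is a union of $n$ (not necessarily bounded) intervals, then the set $\{t\in\mathbb{R}: g(t)>c\}$ is the union of at most $n$ intervals; (ii) if the set $\{t\in\mathbb{R}: f(t)<c\}$ is the union of at most $n$ (not necessarily bounded) intervals, then so is the set $\{t\in\mathbb{R}: g(t)<c\}$.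
   Formalization: The formula φ(s) = λe^{-λs} is proved for all s > 0 only; at s = 0 it can fail, since raising φ(0) above λ preserves Properties 1, 2 and 3 (the averages ignore a single point). *)

(* Defs.v *)
From HB Require Import structures.
From mathcomp Require Import all_boot all_order all_algebra.
From mathcomp Require Import all_classical all_reals all_analysis.

Set Implicit Arguments.
Unset Strict Implicit.
Unset Printing Implicit Defensive.

Import Order.TTheory GRing.Theory Num.Theory.
Import numFieldNormedType.Exports.

Local Open Scope classical_set_scope.
Local Open Scope ring_scope.

(* A weight [0, +oo) -> R is represented by a function phi : R -> R; every
   definition below depends only on its values on [0, +oo). *)

(* The Lebesgue integral of f (t - s) phi(s) over [0, +oo) converges
   absolutely for every t. *)
Definition averageable (R : realType) (phi f : R -> R) : Prop :=
  forall t : R, (@lebesgue_measure R).-integrable `[0, +oo[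
    (fun s : R => (f (t - s) * phi s)%:E).

(* Rintegral takes a default value off the integrable functions, so this is
   the one-sided average only under [averageable phi f]. *)
Definition average (R : realType) (phi f : R -> R) (t : R) : R :=
  Rintegral (@lebesgue_measure R) `[0, +oo[ (fun s : R => f (t - s) * phi s).

Definition preserves_constants (R : realType) (phi : R -> R) : Prop :=
  forall c : R, averageable phi (cst c) /\
    forall t : R, average phi (cst c) t = c.

Definition monotone_weight (R : realType) (phi : R -> R) : Prop :=
  {in `[0, +oo[ &, nonincreasing_fun phi}.

(* The intervals may be unbounded, may overlap, and may be empty. *)
Definition union_of_intervals (R : realType) (n : nat) (A : set R) : Prop :=
  exists I : 'I_n -> interval R, A = \bigcup_(k in [set: 'I_n]) [set` I k].

Definition union_of_at_most_intervals (R : realType) (n : nat) (A : set R) :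
    Prop :=
  exists2 m : nat, (m <= n)%N & union_of_intervals m A.

Definition variation_diminishing (R : realType) (phi : R -> R) : Prop :=
  forall f : R -> R, continuous f -> averageable phi f ->
  forall (c : R) (n : nat),
    (union_of_intervals n [set t | c < f t] ->
     union_of_at_most_intervals n [set t | c < average phi f t]) /\
    (union_of_at_most_intervals n [set t | f t < c] ->
     union_of_at_most_intervals n [set t | average phi f t < c]).

(* Main.v *)
Require Import Defs.
From HB Require Import structures.
From mathcomp Require Import all_boot all_order all_algebra.
From mathcomp Require Import all_classical all_reals all_analysis.
From mathcomp Require Import measurable_realfun.
From mathcomp Require Import zify ring lra.

Set Implicit Arguments.
Unset Strict Implicit.
Unset Printing Implicit Defensive.

Import Order.TTheory GRing.Theory Num.Theory.
Import numFieldNormedType.Exports.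

Local Open Scope classical_set_scope.
Local Open Scope ring_scope.

(** Why the theorem is true.  Write [P] for the right limit of [phi], extended
    by [0] to the negative axis, and [psi = P / P 0].  Averaging a narrow pulse
    of mass one placed at [y] gives nearly [P (t - y)], so a combination [f] of
    pulses averages to nearly the same combination [g] of translates of [P].  If
    [f < 0] holds on a single interval, then so does [g < 0], and [g] cannot take
    the signs -, +, - at three increasing points ([average_no_dip]).  Two choices
    of [f] turn this into inequalities for [psi].

    - With pulses at [0] (negative) and [x] (positive), looking at the points
      [0], [x], [x + y]: [psi (x + y) <= psi x * psi y].
    - With pulses at [0] and [s + u] (positive) and at [s] (negative), looking at
      the points [s], [s + u], [s + u + u]: the minor of order three
<<
        | psi s            1          0     |
        | psi (s + u)      psi u      1     |
        | psi (s + 2 u)    psi (2 u)  psi u |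
>>
      is nonnegative, that is
      [psi u * psi (s + u) - psi (s + 2 u) <= psi s * (psi u ^+ 2 - psi (2 u))].

    The zeros and ones come from the jump of [P] at [0], which is where
    monotonicity enters.  The second inequality bounds the failure of
    multiplicativity at an arbitrary place [s] by its failure [defect u] at the
    origin.  Fix [x] with [psi x > 0].  By submultiplicativity
    [M k = psi (x / 2 ^ k) ^ (2 ^ k)] increases with [k] and is at most [1].
    Telescoping the minor inequality gives [M k - psi x <= 2 ^ k * defect (x / 2
    ^ k)], while [2 ^ k * defect (x / 2 ^ k)] is itself at most a constant times
    the increment [M k - M (k - 1)].  Hence if [M 1 > psi x], the increments stay
    bounded away from [0], contradicting [M k <= 1].  So [psi x = psi (x / 2) ^ 2]
    ([defect_half]): the defect vanishes, [psi] is multiplicative, and, being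
    monotone, it is an exponential ([exponential_of_minors]).  Integrability makes
    the rate [l] positive, and total mass one makes the factor equal to [l]. *)

(** * Monotone solutions of the Cauchy equation *)
Lemma le0_of_natmul_bounded (R : realType) (a b : R) :
  (forall n : nat, n%:R * a <= b) -> a <= 0.
Proof.
move=> h; rewrite leNgt; apply/negP => a0.
have := h (Num.truncn (b / a)).+1; apply/negP; rewrite -ltNge.
by rewrite -ltr_pdivrMr// truncnS_gt.
Qed.

Lemma additive_ge0_linear (R : realType) (G : R -> R) :
  (forall x, 0 <= x -> 0 <= G x) ->
  (forall x y, 0 <= x -> 0 <= y -> G (x + y) = G x + G y) ->
  forall x, 0 <= x -> G x = G 1 * x.
Proof.
move=> G0 GD.
have Gle x y : 0 <= x -> x <= y -> G x <= G y.
  move=> x0 xy; rewrite -(subrK x y) addrC GD ?subr_ge0//.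
  by rewrite lerDl G0// subr_ge0.
have G00 : G 0 = 0 by have := GD 0 0 (lexx _) (lexx _); rewrite addr0; lra.
have GM n x : 0 <= x -> G (n%:R * x) = n%:R * G x.
  move=> x0; elim: n => [|n IHn]; first by rewrite !mul0r.
  by rewrite -natr1 mulrDl mul1r GD ?mulr_ge0// IHn mulrDl mul1r.
move=> x x0.
have key (n : nat) : `|n%:R * (G x - G 1 * x)| <= G 1.
  have nx0 : 0 <= n%:R * x by rewrite mulr_ge0.
  (* Squeeze both [n * G x = G (n * x)] and [n * x * G 1] between the values
     [m * G 1] and [(m + 1) * G 1], where [m] is the integer part of [n * x]. *)
  have /andP[] := truncn_itv nx0; set m := Num.truncn _ => h1 h2.
  have := Gle _ _ (ler0n _ _) h1; have := Gle _ _ nx0 (ltW h2).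
  rewrite GM// -[m%:R]mulr1 -[m.+1%:R]mulr1 !GM// -natr1 => h3 h4.
  have g1 : 0 <= G 1 by exact: G0.
  have h5 := ler_wpM2r g1 h1; have h6 := ler_wpM2r g1 (ltW h2).
  rewrite -natr1 in h6.
  by rewrite ler_norml; apply/andP; split; nra.
apply/eqP; rewrite eq_le; apply/andP; split; rewrite -subr_le0;
  apply: (@le0_of_natmul_bounded _ _ (G 1)) => n; have := key n; rewrite ler_norml; lra.
Qed.

(** The mean value inequality for [x ^+ n], with the slope weakened from
    [n * q ^+ n.-1] to [n * q ^+ n] so that [n = 0] needs no exception. *)
Lemma subX_ge (R : realType) (p q : R) (n : nat) : 0 <= q -> q <= p -> p <= 1 ->
  n%:R * q ^+ n * (p - q) <= p ^+ n - q ^+ n.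
Proof.
move=> q0 qp p1; elim: n => [|n IHn]; first by rewrite !expr0; lra.
have qn0 : 0 <= q ^+ n by rewrite exprn_ge0.
have pq : 0 <= p - q by rewrite subr_ge0.
rewrite !exprS -natr1.
have := ler_wpM2l (le_trans q0 qp) IHn.
have : 0 <= q ^+ n * (p - q) * (1 - q) by rewrite !mulr_ge0//; lra.
have : 0 <= n%:R * q ^+ n * (p - q) * (p - q) by rewrite !mulr_ge0.
nra.
Qed.

(** * Two minor inequalities force an exponential *)

Section rigidity.
Variables (R : realType) (psi : R -> R).
Hypothesis psi0 : psi 0 = 1.
Hypothesis psi_ge0 : forall x, 0 <= psi x.
Hypothesis psi_mono : forall x y, 0 <= x -> x <= y -> psi y <= psi x.
Hypothesis psi_sub : forall x y, 0 < x -> 0 < y -> psi (x + y) <= psi x * psi y.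
Hypothesis psi_minor3 : forall s u, 0 <= s -> 0 < u ->
  psi u * psi (s + u) - psi (s + u + u) <= psi s * (psi u ^+ 2 - psi (u + u)).
Hypothesis psi_pos : exists2 u, 0 < u & 0 < psi u.

Let psi_le1 x : 0 <= x -> psi x <= 1.
Proof. by move=> x0; rewrite -psi0 psi_mono. Qed.

Let defect u := psi u ^+ 2 - psi (u + u).

Let defect_ge0 u : 0 < u -> 0 <= defect u.
Proof. by move=> u0; rewrite subr_ge0 expr2 psi_sub. Qed.

(** Telescoping: passing from [psi (k * u)] to [psi ((k + 1) * u)] differs from
    a multiplication by [psi u] by at most [defect u], wherever [k * u] lies. *)
Lemma powers_sub_le u n : 0 < u ->
  psi u ^+ n.+1 - psi (n.+1%:R * u) <= n.+1%:R * defect u.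
Proof.
move=> u0; elim: n => [|n IHn].
  by rewrite expr1 mul1r subrr mul1r defect_ge0.
have nu0 : 0 <= n%:R * u by rewrite mulr_ge0// ltW.
have := psi_minor3 nu0 u0; rewrite -/(defect u).
have -> : n%:R * u + u + u = n.+2%:R * u by rewrite -!natr1; ring.
have -> : n%:R * u + u = n.+1%:R * u by rewrite -!natr1; ring.
have := ler_wpM2r (defect_ge0 u0) (psi_le1 nu0).
have := ler_wpM2l (psi_ge0 u) IHn.
have d0 : 0 <= n.+1%:R * defect u by rewrite mulr_ge0// defect_ge0.
have := ler_wpM2r d0 (psi_le1 (ltW u0)).
rewrite (exprS _ n.+1) -[n.+2%:R]natr1; nra.
Qed.

Let M x k := psi (x / 2 ^+ k) ^+ (2 ^ k).

(** One dyadic refinement replaces [psi (u + u)] by [psi u ^+ 2] inside a power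
    of exponent [2 ^ k], so the increment of [M] controls [defect u]. *)
Let M_step x k : 0 < x ->
  (2 ^ k)%:R * M x k * defect (x / 2 ^+ k.+1) <= M x k.+1 - M x k.
Proof.
move=> x0; set u := x / 2 ^+ k.+1.
have u0 : 0 < u by rewrite divr_gt0// exprn_gt0.
have uu : x / 2 ^+ k = u + u.
  by rewrite /u exprS; field; rewrite expf_neq0.
rewrite /M expnS exprM -/u uu.
apply: subX_ge => //; last by rewrite exprn_ile1// psi_le1// ltW.
by rewrite -subr_ge0 defect_ge0.
Qed.

Let M_incr x k : 0 < x -> M x k <= M x k.+1.
Proof.
move=> x0; rewrite -subr_ge0; apply: le_trans (M_step k x0).
by rewrite !mulr_ge0// ?exprn_ge0// defect_ge0// divr_gt0// exprn_gt0.
Qed.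

(** If the defect at [x / 2] were positive, [powers_sub_le] and [M_step] would
    bound every increment of the sequence [M x] below by the same positive
    constant, whereas this sequence is at most [1]. *)
Lemma defect_half x : 0 < x -> 0 < psi x -> defect (x / 2) = 0.
Proof.
move=> x0 px0; have xh0 : 0 < x / 2 by rewrite divr_gt0.
apply/eqP; rewrite eq_le defect_ge0// andbT.
have Mx0 : M x 0 = psi x by rewrite /M expr0 divr1 expr1.
have Mx1 : M x 1 = defect (x / 2) + psi x.
  by rewrite /M expr1 expn1 /defect -splitr subrK.
have Mge1 k : M x 1 <= M x k.+1.
  by elim: k => // k IHk; exact: le_trans IHk (M_incr _ _).
have Mge0 k : psi x <= M x k.
  by rewrite -Mx0; elim: k => // k IHk; exact: le_trans IHk (M_incr _ _).
have step k : psi x * defect (x / 2) <= 2 * (M x k.+1 - M x k).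
  have /powers_sub_le : 0 < x / 2 ^+ k.+1 by rewrite divr_gt0// exprn_gt0.
  move=> /(_ (2 ^ k.+1).-1); rewrite prednK ?expn_gt0//.
  have -> : (2 ^ k.+1)%:R * (x / 2 ^+ k.+1) = x.
    by rewrite natrX mulrC divfK// expf_neq0.
  rewrite natrX => h.
  have h1 : defect (x / 2) <= 2 ^+ k.+1 * defect (x / 2 ^+ k.+1).
    by apply: le_trans h; rewrite lerBrDr -Mx1 Mge1.
  have h2 := M_step k x0; rewrite natrX in h2.
  have h3 := ler_wpM2l (ltW px0) h1.
  have d0 : 0 <= 2 ^+ k * defect (x / 2 ^+ k.+1).
    by rewrite mulr_ge0 ?exprn_ge0// defect_ge0// divr_gt0// exprn_gt0.
  have h4 := ler_wpM2l d0 (Mge0 k).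
  by move: h2 h3 h4; set E := defect (x / 2 ^+ k.+1); rewrite exprS; nra.
have bnd k : k%:R * (psi x * defect (x / 2)) <= 2 * (M x k - M x 0).
  elim: k => [|k IHk]; first by rewrite mul0r subrr mulr0.
  by have := step k; rewrite -natr1; lra.
have := @le0_of_natmul_bounded _ (psi x * defect (x / 2)) 2.
rewrite pmulr_rle0//; apply => k; apply: le_trans (bnd k) _.
have : M x k <= 1.
  by rewrite exprn_ile1// psi_le1// ltW// divr_gt0// exprn_gt0.
by rewrite Mx0; lra.
Qed.

(** A vanishing defect makes the minor inequality the converse of
    submultiplicativity. *)
Let psi_mul_le u y : 0 < u -> u <= y -> 0 < psi (u + u) ->
  psi (y + u) = psi y * psi u.
Proof.
move=> u0 uy puu.
have E0 : defect u = 0.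
  have -> : u = (u + u) / 2 by field.
  by rewrite defect_half// addr_gt0.
have s0 : 0 <= y - u by rewrite subr_ge0.
have := psi_minor3 s0 u0; rewrite -/(defect u) E0 mulr0 subrK.
have := psi_sub (lt_le_trans u0 uy) u0.
by rewrite (mulrC (psi y)) => h1 h2; apply/eqP; rewrite eq_le h1/=; lra.
Qed.

Let psi_gt0 x : 0 < psi x \/ x < 0.
Proof.
have [x0|] := leP 0 x; last by right.
(* Positivity spreads from a small [u] to all its multiples, because
   [psi (y + u) = psi y * psi u] is available for that [u]. *)
left; have [v v0 pv] := psi_pos; pose u := v / 2.
have u0 : 0 < u by rewrite divr_gt0.
have uu : u + u = v by rewrite -splitr.
have h n : 0 < psi (n.+1%:R * u).
  elim: n => [|n IHn].
    by rewrite mul1r; apply: lt_le_trans pv _; apply: psi_mono; lra.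
  rewrite -natr1 mulrDl mul1r psi_mul_le ?uu//; last first.
    by rewrite ler_peMl ?ler1n// ltW.
  by rewrite mulr_gt0//; apply: lt_le_trans pv _; apply: psi_mono; lra.
apply: lt_le_trans (h (Num.truncn (x / u))) _; apply: psi_mono => //.
by rewrite -ler_pdivrMr// ltW// truncnS_gt.
Qed.

Theorem exponential_of_minors :
  exists2 l, 0 <= l & forall x, 0 <= x -> psi x = expR (- l * x).
Proof.
have pos x : 0 <= x -> 0 < psi x by case: (psi_gt0 x) => //; lra.
have mul x y : 0 <= x -> 0 <= y -> psi (x + y) = psi x * psi y.
  wlog yx : x y / y <= x => [H x0 y0|x0].
    have [/H->//|/ltW/H] := leP y x.
    by rewrite addrC => ->//; rewrite mulrC.
  rewrite le_eqVlt => /predU1P[<-|y0]; first by rewrite addr0 psi0 mulr1.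
  by apply: psi_mul_le => //; apply: pos; lra.
pose G x := - ln (psi x).
have G_ge0 x : 0 <= x -> 0 <= G x.
  by move=> x0; rewrite oppr_ge0 ln_le0// psi_le1.
exists (G 1) => [|x x0]; first exact: G_ge0.
rewrite mulNr -(@additive_ge0_linear _ G)//.
  by rewrite opprK lnK// posrE pos.
by move=> a b a0 b0; rewrite /G mul// lnM ?posrE ?pos// opprD.
Qed.
End rigidity.

(** * Pulses *)

(** The parabola through [- e] and [0], cut off outside this interval and scaled
    to mass one.  The support lies to the left of the origin, so the average of a
    pulse at time [t] samples the weight on [t, t + e] and tends to its right
    limit at [t]. *)
Definition pulse (R : realType) (e x : R) : R :=
  Num.max 0 (- x * (x + e)) * (6 / e ^+ 3).

Section pulse.
Variables (R : realType) (e : R).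
Hypothesis e0 : 0 < e.
Local Notation mu := (@lebesgue_measure R).

Let c0 : 0 < 6 / e ^+ 3.
Proof. by rewrite divr_gt0// exprn_gt0. Qed.

Lemma pulse_ge0 x : 0 <= pulse e x.
Proof. by rewrite mulr_ge0 ?(ltW c0)// le_max lexx. Qed.

Lemma pulse_in x : - e <= x <= 0 -> pulse e x = - x * (x + e) * (6 / e ^+ 3).
Proof.
move=> /andP[ex x0]; rewrite /pulse max_r// mulr_ge0 ?oppr_ge0//.
by rewrite -lerBlDr sub0r.
Qed.

Lemma pulse_gt0 x : - e < x -> x < 0 -> 0 < pulse e x.
Proof.
move=> ex x0; rewrite pulse_in ?(ltW ex) ?(ltW x0)// mulr_gt0//.
by rewrite mulr_gt0 ?oppr_gt0// -ltrBlDr sub0r.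
Qed.

Lemma pulse_eq0 x : (x <= - e) || (0 <= x) -> pulse e x = 0.
Proof.
move=> h; rewrite /pulse max_l ?mul0r// mulNr oppr_le0.
case/orP: h => h; [rewrite mulr_le0//|rewrite mulr_ge0//]; by move: e0 h; lra.
Qed.

Lemma pulse_le x : pulse e x <= e ^+ 2 * (6 / e ^+ 3).
Proof.
rewrite ler_wpM2r ?(ltW c0)// ge_max sqr_ge0/=.
by rewrite -subr_ge0; have := sqr_ge0 (x + e / 2); have := sqr_ge0 e; nra.
Qed.

Lemma continuous_pulse : continuous (pulse e).
Proof.
move=> x; apply: cvgM; last exact: cvg_cst.
have cst0 : {for x, continuous ((fun=> 0) : R -> R^o)} by exact: cvg_cst.
have cpol : {for x, continuous (fun z : R => - z * (z + e) : R^o)}.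
  by apply: cvgM; [apply: cvgN|apply: cvgD; [|exact: cvg_cst]]; exact: cvg_id.
exact: continuous_max cst0 cpol.
Qed.

Lemma continuous_pulse_sub t : continuous (fun s => pulse e (t - s)).
Proof.
move=> s; apply: (@continuous_comp _ _ _ (fun s => t - s) (pulse e)); last first.
  exact: continuous_pulse.
by apply: cvgB; [exact: cvg_cst|exact: cvg_id].
Qed.

Lemma pulse_mass t : \int[mu]_(s in `[t, t + e]) pulse e (t - s) = 1.
Proof.
(* An antiderivative of the parabola in the variable [s - t]. *)
pose F s := (e * (s - t) ^+ 2 / 2 - (s - t) ^+ 3 / 3) * (6 / e ^+ 3).
have dF (x : R) : is_derive x (1 : R) F ((x - t) * (e - (x - t)) * (6 / e ^+ 3)).
  by rewrite /F; apply: is_derive_eq; rewrite /GRing.scale/=; field; rewrite gt_eqF.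
have cF : continuous F.
  by move=> x; apply/differentiable_continuous/derivable1_diffP; exact: ex_derive.
rewrite /Rintegral (@continuous_FTC2 _ _ F) ?ltrDl//=.
- by rewrite /F; field; rewrite gt_eqF.
- exact/continuous_subspaceT/continuous_pulse_sub.
- split => [x _| |]; first exact: ex_derive.
  + by apply/cvg_at_right_filter; exact: cF.
  + by apply/cvg_at_left_filter; exact: cF.
- move=> x; rewrite in_itv/= => /andP[tx xt].
  rewrite derive1E derive_val pulse_in; first by ring.
  by apply/andP; split; lra.
Qed.

Lemma pulse_integrable t : 0 <= t ->
  mu.-integrable `[0, +oo[ (fun s => (pulse e (t - s))%:E).
Proof.
move=> t0.
have D : `[t, t + e] `<=` `[0, +oo[%classic.
  by move=> s /=; rewrite !in_itv/= andbT => /andP[ts _]; exact: le_trans ts.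
have -> : (fun s => (pulse e (t - s))%:E) =
    (fun s => (pulse e (t - s))%:E) \_ `[t, t + e].
  apply/funext => s; rewrite patchE; case: ifPn => //.
  rewrite notin_setE/= in_itv/= => /negP; rewrite negb_and -!ltNge => h.
  rewrite pulse_eq0//; apply/orP; case/orP: h => h; [right|left]; lra.
apply/integrable_restrict => //; rewrite setIidr//.
apply: continuous_compact_integrable; first exact: segment_compact.
exact/continuous_subspaceT/continuous_pulse_sub.
Qed.

Lemma pulse_half_line t : 0 <= t ->
  \int[mu]_(s in `[0, +oo[) pulse e (t - s) = 1.
Proof.
move=> t0; rewrite -(pulse_mass t) Rintegral_mkcond [RHS]Rintegral_mkcond.
congr (Rintegral _ _ _); apply/funext => s; rewrite !patchE !mem_setE !in_itv/=.
rewrite andbT; case: ifPn => h1; case: ifPn => h2 //.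
  rewrite pulse_eq0//; move: h2; rewrite negb_and -!ltNge.
  by case/orP => h; apply/orP; [right|left]; lra.
by move: h1 h2; rewrite -ltNge => h1 /andP[h2 _]; lra.
Qed.
End pulse.

(** * Averages of bounded functions *)

Section average.
Variables (R : realType) (phi : R -> R).
Local Notation mu := (@lebesgue_measure R).
Hypothesis phi_int : mu.-integrable `[0, +oo[ (EFin \o phi).

Lemma integrable_ge_absurd (c s0 : R) : 0 <= s0 -> 0 < c ->
  ~ (forall s, s0 <= s -> c <= `|phi s|).
Proof.
move=> s00 c0 h.
have /integrableP[mphi] := phi_int; apply/negP; rewrite -leNgt.
have sub : `[s0, +oo[ `<=` `[0, +oo[%classic.
  by move=> s /=; rewrite !in_itv/= !andbT; exact: le_trans.
have mab : measurable_fun (`[0, +oo[%classic : set R) (abse \o (EFin \o phi)).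
  exact: measurableT_comp.
apply: (@le_trans _ _ (\int[mu]_(s in `[s0, +oo[) `|(EFin \o phi) s|)%E).
  apply: (@le_trans _ _ (\int[mu]_(s in `[s0, +oo[) (cst c%:E) s)%E).
    by rewrite integral_cst//= lebesgue_measure_itv/= ltry/= gt0_muley// lte_fin.
  apply: ge0_le_integral => //.
  - by move=> s _ /=; rewrite lee_fin ltW.
  - by apply: measurable_funS mab.
  - by move=> s /=; rewrite in_itv/= andbT => /h; rewrite lee_fin.
exact: ge0_subset_integral.
Qed.

Lemma averageable_bounded (f : R -> R) (C : R) : continuous f ->
  (forall x, `|f x| <= C) -> averageable phi f.
Proof.
move=> cf fC t.
apply: (@integrableMr _ _ _ mu _ _ (fun s => f (t - s)) (EFin \o phi)) => //.
  apply: measurable_funTS; apply: continuous_measurable_fun => s.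
  apply: (@continuous_comp _ _ _ (fun s => t - s) f); last exact: cf.
  by apply: cvgB; [exact: cvg_cst|exact: cvg_id].
exists C; split; first exact: num_real.
by move=> x Cx s _; exact: le_trans (fC _) (ltW Cx).
Qed.

End average.

(** * The right limit of the weight *)

(** For a nonincreasing weight the supremum is the limit from the right.  The
    value [0] on the negative axis is the weight that the one-sided average gives
    to the future. *)
Definition right_limit (R : realType) (phi : R -> R) (t : R) : R :=
  if t < 0 then 0 else sup [set phi s | s in `]t, +oo[].

Section right_limit.
Variables (R : realType) (phi : R -> R).
Hypothesis phi_mono : monotone_weight phi.

Let mono x y : 0 <= x -> x <= y -> phi y <= phi x.
Proof.
move=> x0 xy; apply: phi_mono => //; rewrite in_itv/= andbT//.
exact: le_trans xy.
Qed.

Let ub t : 0 <= t -> ubound [set phi s | s in `]t, +oo[] (phi t).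
Proof.
move=> t0 x [s /=]; rewrite in_itv/= andbT => ts <-.
by apply: mono => //; exact: ltW.
Qed.

Let nonempty t : [set phi s | s in `]t, +oo[] !=set0.
Proof. by exists (phi (t + 1)), (t + 1) => //=; rewrite in_itv/= andbT ltrDl. Qed.

Lemma right_limit_lt0 t : t < 0 -> right_limit phi t = 0.
Proof. by rewrite /right_limit => ->. Qed.

Lemma right_limit_le t : 0 <= t -> right_limit phi t <= phi t.
Proof.
by move=> t0; rewrite /right_limit ltNge t0/=; apply: ge_sup => //; exact: ub.
Qed.

Lemma le_right_limit t s : 0 <= t -> t < s -> phi s <= right_limit phi t.
Proof.
move=> t0 ts; rewrite /right_limit ltNge t0/=; apply: ub_le_sup.
  by exists (phi t); exact: ub.
by exists s => //=; rewrite in_itv/= andbT.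
Qed.

Lemma right_limit_adherent t d : 0 <= t -> 0 < d ->
  exists2 s, t < s & right_limit phi t - d < phi s.
Proof.
move=> t0 d0; have hs : has_sup [set phi s | s in `]t, +oo[].
  by split => //; exists (phi t); exact: ub.
have [_ [s /= + <-]] := sup_adherent d0 hs.
rewrite in_itv/= andbT => ts h; exists s => //.
by rewrite /right_limit (ltNge t) t0.
Qed.

Lemma right_limit_mono t s : 0 <= t -> t <= s ->
  right_limit phi s <= right_limit phi t.
Proof.
move=> t0; rewrite le_eqVlt => /predU1P[->//|ts].
apply: le_trans (le_right_limit t0 ts); apply: right_limit_le.
exact: le_trans (ltW ts).
Qed.

End right_limit.

(** * Variation diminishing on combinations of pulses *)

Section variation.
Variables (R : realType) (phi : R -> R).
Local Notation mu := (@lebesgue_measure R).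
Hypothesis phi_int : mu.-integrable `[0, +oo[ (EFin \o phi).
Hypothesis phi_mono : monotone_weight phi.
Local Notation P := (right_limit phi).

(** A negative value would be an upper bound from there on, and the weight would
    not be integrable. *)
Lemma weight_ge0 s : 0 <= s -> 0 <= phi s.
Proof.
move=> s0; rewrite leNgt; apply/negP => ps.
apply: (@integrable_ge_absurd _ phi phi_int (- phi s) s) => //.
  by rewrite oppr_gt0.
move=> x sx; have : phi x <= phi s.
  by apply: phi_mono => //; rewrite in_itv/= andbT//; exact: le_trans sx.
by move=> px; rewrite ler0_norm; lra.
Qed.

Lemma right_limit_ge0 t : 0 <= P t.
Proof.
have [/right_limit_lt0->//|t0] := ltP t 0.
have t1 : t < t + 1 by rewrite ltrDl.
apply: le_trans (le_right_limit phi_mono t0 t1); apply: weight_ge0.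
by rewrite addr_ge0.
Qed.

Let continuous_pulse_shift (e y : R) : 0 < e ->
  continuous (fun x => pulse e (x - y)).
Proof.
move=> e0 x; apply: (@continuous_comp _ _ _ (fun s => s - y) (pulse e)).
  by apply: cvgB; [exact: cvg_id|exact: cvg_cst].
exact: continuous_pulse.
Qed.

Let integrable_scale (k : R) (h : R -> R) :
  mu.-integrable `[0, +oo[ (EFin \o h) ->
  mu.-integrable `[0, +oo[ (EFin \o (fun s => k * h s)).
Proof. by move=> ih; exact: (integrableZl _ k ih). Qed.

Let integrable_add (h k : R -> R) :
  mu.-integrable `[0, +oo[ (EFin \o h) ->
  mu.-integrable `[0, +oo[ (EFin \o k) ->
  mu.-integrable `[0, +oo[ (EFin \o (fun s => h s + k s)).
Proof.
by move=> ih ik; apply: (@integrableD _ _ _ mu _ _ (EFin \o h) (EFin \o k)).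
Qed.

Let pulse_avg (e y : R) : 0 < e -> averageable phi (fun x => pulse e (x - y)).
Proof.
move=> e0; apply: (averageable_bounded phi_int (C := e ^+ 2 * (6 / e ^+ 3))).
  exact: continuous_pulse_shift.
by move=> x; rewrite ger0_norm ?pulse_ge0 ?pulse_le.
Qed.

Let pulse_avg0 (e : R) : 0 < e -> averageable phi (pulse e).
Proof.
move=> e0; rewrite (_ : pulse e = fun x => pulse e (x - 0)); first exact: pulse_avg.
by apply/funext => x; rewrite subr0.
Qed.

(** The average lies between [phi (t + e)] and the right limit at [t]; the open
    support matters for the upper bound, as [phi t] may exceed the right limit. *)
Lemma average_pulse_cvg t : average phi (pulse e) t @[e --> 0^'+] --> P t.
Proof.
have [t0|t0] := ltP t 0.
  rewrite right_limit_lt0//; apply: cvg_near_cst; near=> e.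
  have e0 : 0 < e by [].
  have et : e < - t.
    by near: e; apply: nbhs_right_lt; rewrite oppr_gt0.
  rewrite /average -[RHS](mul0r (fine (mu `[0, +oo[))) -Rintegral_cst//.
  apply: eq_Rintegral => s; rewrite inE/= in_itv/= andbT => s0.
  by rewrite pulse_eq0 ?mul0r//; apply/orP; left; lra.
apply/cvgrPdist_le => d d0.
have [s ts ps] := right_limit_adherent phi_mono t0 d0.
near=> e; have e0 : 0 < e by [].
have es : t + e < s.
  by rewrite -ltrBrDl; near: e; apply: nbhs_right_lt; rewrite subr_gt0.
have te0 : 0 <= t + e by rewrite addr_ge0// ltW.
have phie : phi s <= phi (t + e).
  by apply: le_trans (right_limit_le phi_mono te0); exact: le_right_limit.
have mb : mu.-integrable `[0, +oo[ (EFin \o (fun s => pulse e (t - s))).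
  exact: pulse_integrable.
have cstb c : mu.-integrable `[0, +oo[ (EFin \o (fun s => pulse e (t - s) * c)).
  have -> : EFin \o (fun s => pulse e (t - s) * c) =
      (fun s => (EFin \o (fun s => pulse e (t - s))) s * c%:E)%E.
    by apply/funext.
  exact: integrableZr.
have Ecst c : c = \int[mu]_(s in `[0, +oo[) (pulse e (t - s) * c).
  by rewrite RintegralZr// pulse_half_line// mul1r.
have lo : phi (t + e) <= average phi (pulse e) t.
  rewrite [leLHS]Ecst; apply: le_Rintegral => //; first exact: pulse_avg0.
  move=> x /=; rewrite in_itv/= andbT => x0.
  have [xte|tex] := leP x (t + e).
    rewrite ler_wpM2l ?pulse_ge0//.
    by apply: phi_mono => //; rewrite in_itv/= andbT.
  by rewrite pulse_eq0 ?mul0r//; apply/orP; left; lra.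
have hi : average phi (pulse e) t <= P t.
  rewrite [leRHS]Ecst; apply: le_Rintegral => //; first exact: pulse_avg0.
  move=> x /=; rewrite in_itv/= andbT => x0.
  have [xt|tx] := leP x t.
    by rewrite pulse_eq0 ?mul0r// subr_ge0 xt orbT.
  by rewrite ler_wpM2l ?pulse_ge0// le_right_limit.
by rewrite ler_norml; apply/andP; split; lra.
Unshelve. all: end_near. Qed.

Lemma union_at_most1_interval (A : set R) :
  union_of_at_most_intervals 1 A -> is_interval A.
Proof.
case=> m m1 [I ->] x y [i _ Ix] [j _ Iy] z xzy.
have ij : j = i by apply/val_inj => /=; move: (ltn_ord i) (ltn_ord j) m1; lia.
by exists i => //; apply: (interval_is_interval Ix) xzy; rewrite -ij.
Qed.

Hypothesis phi_vd : variation_diminishing phi.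

(** Strict signs of the limit combination [G] survive for narrow pulses, whose
    averages are negative on one interval only.  The threshold is [0], and [c = 0]
    covers combinations of two pulses. *)
Lemma average_no_dip (a b c y z x1 x2 x3 : R) :
  (\forall e \near 0^'+, exists I : interval R,
    [set x | a * pulse e x + b * pulse e (x - y) + c * pulse e (x - z) < 0] =
    [set` I]) ->
  let G t := a * P t + b * P (t - y) + c * P (t - z) in
  x1 < x2 -> x2 < x3 -> G x1 < 0 -> 0 < G x2 -> G x3 < 0 -> False.
Proof.
move=> nearI G x12 x23 g1 g2 g3.
pose f e x := a * pulse e x + b * pulse e (x - y) + c * pulse e (x - z).
have fE e t : 0 < e -> average phi (f e) t = a * average phi (pulse e) t +
    b * average phi (pulse e) (t - y) + c * average phi (pulse e) (t - z).
  move=> e0; rewrite /average.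
  have i1 := pulse_avg0 e0 t.
  have i2 := pulse_avg0 e0 (t - y).
  have i3 := pulse_avg0 e0 (t - z).
  have iZ := integrable_scale.
  rewrite -!RintegralZl// -!RintegralD//; try exact: iZ; last first.
    by apply: integrable_add; exact: iZ.
  apply: eq_Rintegral => s _.
  by rewrite /f (addrAC t (- y)) (addrAC t (- z)); ring.
have fcvg t : average phi (f e) t @[e --> 0^'+] --> G t.
  have : (a * average phi (pulse e) t + b * average phi (pulse e) (t - y) +
      c * average phi (pulse e) (t - z)) @[e --> 0^'+] --> G t.
    by apply: cvgD; [apply: cvgD|]; apply: cvgMr; exact: average_pulse_cvg.
  apply: cvg_trans; apply: near_eq_cvg; near=> e.
  by rewrite fE.
have : \forall e \near (0 : R)^'+, False.
  near=> e.
  have e0 : 0 < e by [].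
  have cf : continuous (f e).
    move=> x; apply: cvgD; [apply: cvgD|]; apply: cvgMr.
    - exact: continuous_pulse.
    - exact: continuous_pulse_shift.
    - exact: continuous_pulse_shift.
  have af : averageable phi (f e).
    move=> t; have -> : (fun s => (f e (t - s) * phi s)%:E) = EFin \o (fun s =>
        a * (pulse e (t - s) * phi s) + b * (pulse e (t - s - y) * phi s) +
        c * (pulse e (t - s - z) * phi s)).
      by apply/funext => s /=; rewrite /f; congr (_%:E); ring.
    apply: integrable_add; [apply: integrable_add|]; apply: integrable_scale.
    - exact: pulse_avg0.
    - exact: pulse_avg.
    - exact: pulse_avg.
  have [I fI] : exists I : interval R, [set x | f e x < 0] = [set` I].
    by near: e.
  have /union_at_most1_interval : union_of_at_most_intervals 1
      [set t | average phi (f e) t < 0].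
    apply: (proj2 (phi_vd cf af 0 1%N)); exists 1%N => //.
    exists (fun=> I); rewrite fI; apply/seteqP; split => [x Ix|x [_ _ Ix]//].
    by exists ord0.
  have h1 : average phi (f e) x1 < 0.
    by near: e; apply: cvgr_lt (fcvg x1) _ g1.
  have h2 : 0 < average phi (f e) x2.
    by near: e; apply: cvgr_gt (fcvg x2) _ g2.
  have h3 : average phi (f e) x3 < 0.
    by near: e; apply: cvgr_lt (fcvg x3) _ g3.
  move=> /(_ x1 x3 h1 h3 x2) /=; rewrite !ltW// => /(_ isT); lra.
by move=> /(@filter_ex _ _ _) [].
Unshelve. all: end_near. Qed.

End variation.

(** * The normalised weight and its minors *)

Section normalised_weight.
Variables (R : realType) (phi : R -> R).
Local Notation mu := (@lebesgue_measure R).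
Hypothesis phi_const : preserves_constants phi.
Hypothesis phi_mono : monotone_weight phi.
Hypothesis phi_vd : variation_diminishing phi.
Local Notation P := (right_limit phi).

Lemma weight_integrable : mu.-integrable `[0, +oo[ (EFin \o phi).
Proof.
have [/(_ 0) + _] := phi_const 1; congr (_.-integrable _ _).
by apply/funext => s /=; rewrite mul1r.
Qed.

Let phi_int := weight_integrable.

Let phi_open : mu.-integrable `]0, +oo[ (EFin \o phi).
Proof.
apply: integrableS phi_int => //.
by move=> s /=; rewrite !in_itv/= !andbT => /ltW.
Qed.

Lemma weight_total : \int[mu]_(s in `]0, +oo[) phi s = 1.
Proof.
have [_ /(_ 0) <-] := phi_const 1; rewrite Rintegral_itv_obnd_cbnd//.
by apply: eq_Rintegral => s _; rewrite mul1r.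
Qed.

Lemma right_limit0_gt0 : 0 < P 0.
Proof.
rewrite ltNge; apply/negP => P0; have := weight_total.
suff -> : \int[mu]_(s in `]0, +oo[) phi s = 0 by move/eqP; rewrite eq_sym oner_eq0.
rewrite -[RHS](mul0r (fine (mu `]0, +oo[))) -Rintegral_cst//.
apply: eq_Rintegral => s; rewrite inE/= in_itv/= andbT => s0.
apply/eqP; rewrite eq_le (weight_ge0 phi_int phi_mono (ltW s0)) andbT.
exact: le_trans (le_right_limit phi_mono _ s0) P0.
Qed.

Let psi t := P t / P 0.

Let PE t : P t = P 0 * psi t.
Proof. by rewrite /psi mulrC divfK// gt_eqF// right_limit0_gt0. Qed.

Let psi0 : psi 0 = 1.
Proof. by rewrite /psi divff// gt_eqF// right_limit0_gt0. Qed.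

Let psi_ge0 t : 0 <= psi t.
Proof. by rewrite divr_ge0// right_limit_ge0. Qed.

Let psi_lt0 t : t < 0 -> psi t = 0.
Proof. by move=> t0; rewrite /psi right_limit_lt0// mul0r. Qed.

Let psi_mono x y : 0 <= x -> x <= y -> psi y <= psi x.
Proof.
move=> x0 xy; rewrite ler_wpM2r ?invr_ge0 ?right_limit_ge0//.
exact: right_limit_mono.
Qed.

Let no_dip (a b c y z x1 x2 x3 : R) :
  (\forall e \near 0^'+, exists I : interval R,
    [set x | a * pulse e x + b * pulse e (x - y) + c * pulse e (x - z) < 0] =
    [set` I]) ->
  let H t := a * psi t + b * psi (t - y) + c * psi (t - z) in
  x1 < x2 -> x2 < x3 -> H x1 < 0 -> 0 < H x2 -> H x3 < 0 -> False.
Proof.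
move=> nearI H x12 x23.
have HE t : a * P t + b * P (t - y) + c * P (t - z) = P 0 * H t.
  by rewrite (PE t) (PE (t - y)) (PE (t - z)) /H; ring.
have P0 := right_limit0_gt0.
rewrite -(pmulr_rlt0 (H x1) P0) -(pmulr_rgt0 (H x2) P0) -(pmulr_rlt0 (H x3) P0).
rewrite -!HE; exact: average_no_dip.
Qed.

(** A violation leaves room for a coefficient [b] between [psi x] and
    [psi (x + y) / psi y]; then [- psi t + b * psi (t - x)] has the signs -, +, -
    at [0], [x], [x + y], the first one because [psi] vanishes before [0]. *)
Let psi_sub x y : 0 < x -> 0 < y -> psi (x + y) <= psi x * psi y.
Proof.
move=> x0 y0; rewrite leNgt; apply/negP => viol.
have py : 0 < psi y.
  apply: le_lt_trans (_ : _ <= psi x * psi y) _; first exact: mulr_ge0.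
  by apply: lt_le_trans viol _; apply: psi_mono; lra.
pose b := (psi x + psi (x + y) / psi y) / 2.
have bx : psi x < psi (x + y) / psi y by rewrite ltr_pdivlMr.
have b1 : psi x < b by rewrite /b; lra.
have b2 : b * psi y < psi (x + y) by rewrite -ltr_pdivlMr// /b; lra.
have b0 : 0 <= b by apply: le_trans (psi_ge0 x) (ltW b1).
apply: (@no_dip (-1) b 0 x 0 0 x (x + y)); rewrite ?ltrDl//.
- near=> e; have e0 : 0 < e by [].
  have ex : e < x by near: e; exact: nbhs_right_lt.
  exists `]- e, 0[; apply/seteqP; split => t /=; rewrite in_itv/=.
    apply: contraTT; rewrite negb_and -!leNgt orbC => /orP h.
    have -> : pulse e t = 0 by rewrite pulse_eq0//; case: h => ->; rewrite ?orbT.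
    by rewrite mulr0 mul0r addr0 add0r mulr_ge0// pulse_ge0.
  move=> /andP[et t0]; rewrite [pulse e (t - x)]pulse_eq0//; last first.
    by apply/orP; left; lra.
  by have := pulse_gt0 e0 et t0; lra.
- by rewrite psi0 sub0r psi_lt0 ?oppr_lt0//; lra.
- by rewrite subrr psi0; lra.
- by rewrite (addrC x) addrK (addrC y); lra.
Unshelve. all: end_near. Qed.

(** In [a * psi t - psi (t - s) + c * psi (t - (s + u))] the signs -, +, - at [s],
    [s + u], [s + u + u] ask for [a * psi s < 1] and [lo < c < hi].  The interval
    is nonempty when [D < a * W], and a violation says that such an [a] exists.
    Submultiplicativity gives [0 <= lo], so that [c] is nonnegative and the
    combination of pulses is negative only on the pulse at [s]. *)
Let psi_minor3 s u : 0 <= s -> 0 < u ->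
  psi u * psi (s + u) - psi (s + u + u) <= psi s * (psi u ^+ 2 - psi (u + u)).
Proof.
rewrite le_eqVlt => /predU1P[<- _|s0 u0].
  by rewrite !add0r psi0 mul1r expr2.
rewrite leNgt; apply/negP => viol.
have su0 : 0 < s + u by rewrite addr_gt0.
set D := psi u ^+ 2 - psi (u + u) in viol.
set W := psi u * psi (s + u) - psi (s + u + u) in viol.
have D0 : 0 <= D by rewrite subr_ge0 expr2 psi_sub.
have W0 : 0 < W by apply: le_lt_trans viol; rewrite mulr_ge0.
have Wle : W <= psi u * psi (s + u) by rewrite lerBlDr lerDl.
have pu : 0 < psi u.
  rewrite lt_def psi_ge0 andbT; apply/eqP => pu.
  by move: W0 Wle; rewrite pu mul0r; lra.
have ps : 0 < psi s.
  apply: (@lt_le_trans _ _ (psi (s + u))); last by apply: psi_mono; lra.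
  rewrite lt_def psi_ge0 andbT; apply/eqP => psu.
  by move: W0 Wle; rewrite psu mulr0; lra.
pose a := (D / W + (psi s)^-1) / 2.
have DW : D / W < (psi s)^-1.
  by rewrite ltr_pdivrMr// mulrC ltr_pdivlMr// mulrC.
have DW0 : 0 <= D / W by rewrite divr_ge0// ltW.
have a0 : 0 < a by rewrite /a; lra.
have as1 : a * psi s < 1 by rewrite -ltr_pdivlMr// mul1r /a; lra.
have aW : D < a * W by rewrite -ltr_pdivrMr// /a; lra.
pose lo := psi u - a * psi (s + u).
pose hi := (psi (u + u) - a * psi (s + u + u)) / psi u.
have lohi : lo < hi.
  by rewrite ltr_pdivlMr// /lo; move: aW; rewrite /D /W; lra.
have lo0 : 0 <= lo.
  rewrite subr_ge0; apply: le_trans (ler_wpM2l (ltW a0) (psi_sub s0 u0)) _.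
  by rewrite mulrA ler_piMl// ltW.
pose c := (lo + hi) / 2.
have c0 : 0 <= c by rewrite /c; lra.
have c1 : lo < c by rewrite /c; lra.
have c2 : c * psi u < psi (u + u) - a * psi (s + u + u).
  by rewrite -ltr_pdivlMr// -/hi /c; lra.
have e1 : s - (s + u) = - u by ring.
have e2 : s + u - s = u by ring.
have e3 : s + u + u - s = u + u by ring.
have e4 : s + u + u - (s + u) = u by ring.
apply: (@no_dip a (-1) c s (s + u) s (s + u) (s + u + u)); rewrite ?ltrDl//.
- near=> e; have e0 : 0 < e by [].
  have es : e < s by near: e; exact: nbhs_right_lt.
  have eu : e < u by near: e; exact: nbhs_right_lt.
  exists `]s - e, s[; apply/seteqP; split => t /=; rewrite in_itv/=.
    apply: contraTT; rewrite negb_and -!leNgt => /orP h.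
    rewrite [pulse e (t - s)]pulse_eq0//; last first.
      by apply/orP; case: h => h; [left|right]; lra.
    by rewrite mulr0 addr0 addr_ge0// mulr_ge0// ?pulse_ge0// ltW.
  move=> /andP[et ts]; rewrite [pulse e t]pulse_eq0//; last first.
    by apply/orP; right; lra.
  rewrite [pulse e (t - (s + u))]pulse_eq0//; last by apply/orP; left; lra.
  have : 0 < pulse e (t - s) by apply: pulse_gt0; lra.
  lra.
- by rewrite subrr psi0 e1 (@psi_lt0 (- u)) ?oppr_lt0//; lra.
- by rewrite e2 subrr psi0; move: c1; rewrite /lo; lra.
- by rewrite e3 e4; lra.
Unshelve. all: end_near. Qed.

Let psi_pos : exists2 u, 0 < u & 0 < psi u.
Proof.
have P0 := right_limit0_gt0.
have [s s0] := right_limit_adherent phi_mono (lexx 0) P0.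
rewrite subrr => ps; exists (s / 2); first by rewrite divr_gt0.
rewrite divr_gt0//; apply: lt_le_trans ps _; apply: le_right_limit => //; lra.
Qed.

(** [P] is continuous on the positive axis once it is known to be exponential, and
    [P s <= phi s <= P t] for [t < s] identifies [phi] with it. *)
Lemma weight_exponential : exists l A : R, [/\ 0 <= l, 0 < A &
  forall s, 0 < s -> phi s = A * expR (- l * s)].
Proof.
have [l l0 psiE] :=
  exponential_of_minors psi0 psi_ge0 psi_mono psi_sub psi_minor3 psi_pos.
exists l, (P 0); split => // [|s s0]; first exact: right_limit0_gt0.
have PsE t : 0 <= t -> P t = P 0 * expR (- l * t) by move=> t0; rewrite PE psiE.
apply/eqP; rewrite eq_le; apply/andP; split; last first.
  by rewrite -PsE ?(ltW s0)// right_limit_le ?(ltW s0).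
have : P 0 * expR (- l * t) @[t --> s^'-] --> P 0 * expR (- l * s).
  apply: cvg_at_left_filter; apply: cvgMr.
  apply: (@continuous_comp _ _ _ (fun t => - l * t) expR).
    by apply: cvgMr; exact: cvg_id.
  exact: continuous_expR.
move=> /cvgr_to_ge; apply; near=> t.
have t0 : 0 < t by near: t; exact: nbhs_left_gt.
have ts : t < s by [].
by rewrite -PsE ?(ltW t0)// le_right_limit// ltW.
Unshelve. all: end_near. Qed.

End normalised_weight.

(** * The weight is an exponential density *)

(* The three hypotheses do not determine phi 0: replacing it by any larger
   value preserves all of them.  Hence the equality is over 0 < s. *)
Theorem mainTheorem1 (R : realType) (phi : R -> R)
  (phi_const : preserves_constants phi)
  (phi_mono : monotone_weight phi)
  (phi_vd : variation_diminishing phi) :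
  exists2 lambda : R, 0 < lambda &
    forall s : R, 0 < s -> phi s = lambda * expR (- lambda * s).
Proof.
have [l [A [l0 A0 phiE]]] := weight_exponential phi_const phi_mono phi_vd.
have phi_int := weight_integrable phi_const.
have {}l0 : 0 < l.
  move: l0; rewrite le_eqVlt => /predU1P[l0|//]; exfalso.
  apply: (integrable_ge_absurd phi_int ler01 A0) => s s1.
  rewrite phiE ?(lt_le_trans _ s1)// -l0 oppr0 mul0r expR0 mulr1.
  exact: ler_norm.
suff Al : A = l by exists l => // s s0; rewrite phiE// Al.
have := weight_total phi_const.
have -> : \int[lebesgue_measure]_(s in `]0, +oo[) phi s =
    \int[lebesgue_measure]_(s in `]0, +oo[) (A / l * exponential_pdf l s).
  apply: eq_Rintegral => s; rewrite inE/= in_itv/= andbT => s0.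
  by rewrite phiE// exponential_pdfE ?ltW// mulrA divfK// gt_eqF.
rewrite RintegralZl//; last first.
  exact: integrableS (integrable_exponential_pdf l0).
rewrite Rintegral_itv_obnd_cbnd; last first.
  exact: integrableS (integrable_exponential_pdf l0).
rewrite Rintegral_mkcond (_ : _ \_ _ = exponential_pdf l); last first.
  by apply/funext => x; rewrite /exponential_pdf !patchE; case: ifP => // ->.
rewrite /Rintegral integral_exponential_pdf//= mulr1 => /(congr1 ( *%R^~ l)).
by rewrite divfK ?mul1r// gt_eqF.
Qed.
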